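(* Let $\mathcal{P}$ be a convex polyomino. Then $K[\mathcal{P}]$ is inseparable.
   Context: $K$ is a field of characteristic $0$. Polyominoes: for $a,b\in\mathbb{Z}^2_+$ (componentwise order) the interval $[a,b]$ is $\{c\in\mathbb{Z}_+^2:a\le c\le b\}$. A cell is an interval $[a,a+(1,1)]$; its four elements are its vertices, and its edges are $[a,a+(1,0)]$, $[a+(1,0),a+(1,1)]$, $[a+(0,1),a+(1,1)]$, $[a,a+(0,1)]$. A polyomino $\mathcal{P}$ is a finite (nonempty) collection of cells such that any two cells $C,D\in\mathcal{P}$ are connected by a sequence $C=C_1,\ldots,C_t=D$ of cells of $\mathcal{P}$ with $C_i$ and $C_{i+1}$ intersecting in an edge for all $i$. $V(\mathcal{P})$ is the union of the vertex sets of its cells. $\mathcal{P}$ is convex if its intersection (as a planar region, the union of the unit squares of its cells) with every vertical line and with every horizontal line is convex. $S=K[x_{ij}:(i,j)\in V(\mathcal{P})]$. An inner minor is $x_{ij}x_{kl}-x_{il}x_{kj}$ with $i<k$, $j<l$ such that all cells $[(r,s),(r+1,s+1)]$ with $i\le r\le k-1$, $j\le s\le l-1$ belong to $\mathcal{P}$. $I_{\mathcal{P}}$ is the ideal generated by all inner minors and $K[\mathcal{P}]=S/I_{\mathcal{P}}$. For $\mathcal{P}$ convex it is known that $I_{\mathcal{P}}$ is the kernel of the $K$-algebra map $x_{ij}\mapsto h_iv_j$ into a polynomial ring in variables $h_i,v_j$; thus $K[\mathcal{P}]$ is a toric ring, $I_{\mathcal{P}}=I_L$ for the relation lattice $L\subset\mathbb{Z}^n$,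 $n=|V(\mathcal{P})|$, consisting of all integer vectors $(u_{ij})_{(i,j)\in V(\mathcal{P})}$ with $\sum_ju_{ij}=0$ for all $i$ and $\sum_iu_{ij}=0$ for all $j$. $K[\mathcal{P}]$ is inseparable if $L$ is inseparable in the following sense (variables of $S$ renamed $x_1,\ldots,x_n$). For $v\in\mathbb{Z}^n$ put $f_v=\prod_{v(i)\ge0}x_i^{v(i)}-\prod_{v(i)\le0}x_i^{-v(i)}$; for a lattice $L$, $I_L=(f_v:v\in L)$; $L$ is saturated if $\mathbb{Z}^n/L$ is torsionfree. Let $\pi_i:S[x_{n+1}]\to S$ be the $K$-algebra map with $\pi_i(x_j)=x_j$ ($j\le n$), $\pi_i(x_{n+1})=x_i$. A saturated $L\subset\mathbb{Z}^n$ is $i$-separable if there is a saturated $L'\subset\mathbb{Z}^{n+1}$ such that (i) $\operatorname{rank}L'=\operatorname{rank}L$; (ii) $\pi_i(I_{L'})=I_L$; (iii) there is a minimal system of generators $f_{w_1},\ldots,f_{w_s}$ of $I_{L'}$ such that $(w_1(n+1),\ldots,w_s(n+1))$ and $(w_1(i),\ldots,w_s(i))$ are linearly independent. $L$ is inseparable if it is not $i$-separable for any $i\in\{1,\ldots,n\}$. *)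

(* Defs.v *)
From Stdlib Require Import Reals.
From mathcomp Require Import all_boot all_order all_algebra.
From mathcomp Require Import finmap.
From mathcomp.multinomials Require Import mpoly.

Set Implicit Arguments.
Unset Strict Implicit.
Unset Printing Implicit Defensive.

Import GRing.Theory.

(** * Polyominoes *)

Definition point := (nat * nat)%type.

Definition le_point (a b : point) : bool := (a.1 <= b.1) && (a.2 <= b.2).

Definition interval (a b : point) : {fset point} :=
  [fset c in [seq (i, j) | i <- iota 0 b.1.+1, j <- iota 0 b.2.+1]
     | le_point a c]%fset.

Lemma in_interval a b c :
  (c \in interval a b) = le_point a c && le_point c b.
Proof.
have E : (c \in [seq (i, j) | i <- iota 0 b.1.+1, j <- iota 0 b.2.+1]) =
         le_point c b.
  case: c => c1 c2; apply/allpairsP/idP => [[[i j] []]|/andP[H1 H2]].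
    by rewrite !mem_iota !add0n !ltnS => H1 H2 [-> ->]; apply/andP.
  by exists (c1, c2); rewrite !mem_iota !add0n !ltnS.
by rewrite andbC -E /interval; move: [seq _ | _ <- _, _ <- _] => s; rewrite !inE.
Qed.

Definition shift (a : point) (i j : nat) : point := (a.1 + i, a.2 + j).

(* A cell is encoded by its lower left corner. *)
Definition cell (a : point) : {fset point} := interval a (shift a 1 1).

Definition edges (a : point) : seq {fset point} :=
  [:: interval a (shift a 1 0);
      interval (shift a 1 0) (shift a 1 1);
      interval (shift a 0 1) (shift a 1 1);
      interval a (shift a 0 1)].

Definition edge_adjacent (a b : point) : bool :=
  let I := (cell a `&` cell b)%fset in (I \in edges a) && (I \in edges b).

(* [P] is the set of the lower left corners of the cells. *)
Definition polyomino (P : {fset point}) : Prop :=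
  P != fset0 /\
  forall a b, a \in P -> b \in P ->
    exists s : seq point,
      [/\ all (mem P) s, path edge_adjacent a s & last a s = b].

Definition vertices (P : {fset point}) : {fset point} :=
  (\bigcup_(a <- P) cell a)%fset.

Section Region.
Local Open Scope R_scope.

Definition plane := (R * R)%type.

Definition unit_square (a : point) (z : plane) : Prop :=
  (INR a.1 <= z.1 <= INR a.1 + 1) /\ (INR a.2 <= z.2 <= INR a.2 + 1).

Definition region (P : {fset point}) (z : plane) : Prop :=
  exists2 a, a \in P & unit_square a z.

Definition planar_convex (A : plane -> Prop) : Prop :=
  forall (p q : plane) (t : R), A p -> A q -> 0 <= t <= 1 ->
    A ((1 - t) * p.1 + t * q.1, (1 - t) * p.2 + t * q.2).

Definition convex (P : {fset point}) : Prop :=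
  (forall x : R, planar_convex (fun z => region P z /\ z.1 = x)) /\
  (forall y : R, planar_convex (fun z => region P z /\ z.2 = y)).

End Region.

Local Open Scope ring_scope.

(** * Lattices in Z^n *)

Definition is_lattice n (L : 'rV[int]_n -> Prop) : Prop :=
  L 0 /\ forall u v, L u -> L v -> L (u - v).

Definition saturated n (L : 'rV[int]_n -> Prop) : Prop :=
  forall (m : int) (v : 'rV[int]_n), m != 0 -> L (m *: v) -> L v.

(* [L] has a Z-basis with [r] elements, the rows of [B]. *)
Definition has_rank n (L : 'rV[int]_n -> Prop) (r : nat) : Prop :=
  exists B : 'M[int]_(r, n),
    row_free (map_mx (fun z : int => z%:~R : rat) B) /\
    forall v, L v <-> exists c : 'rV[int]_r, v = c *m B.

(** * Lattice ideals *)

Definition ideal_gen (A : comNzRingType) (G : A -> Prop) (p : A) : Prop :=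
  exists s : seq (A * A),
    (forall q, q \in s -> G q.2) /\ p = \sum_(q <- s) q.1 * q.2.

Definition same_set (A : Type) (I J : A -> Prop) : Prop :=
  forall p, I p <-> J p.

Definition lattice_binomial (K : fieldType) n (v : 'rV[int]_n) : {mpoly K[n]} :=
  \prod_(i < n | 0 <= v 0 i) 'X_i ^+ absz (v 0 i)
  - \prod_(i < n | v 0 i <= 0) 'X_i ^+ absz (v 0 i).

Definition lattice_ideal (K : fieldType) n (L : 'rV[int]_n -> Prop) :
    {mpoly K[n]} -> Prop :=
  ideal_gen (fun p => exists2 v, L v & p = lattice_binomial K v).

Definition minimal_generators (A : comNzRingType) (I : A -> Prop) s
    (g : 'I_s -> A) : Prop :=
  let gen (T : {set 'I_s}) :=
    ideal_gen (fun p => exists2 j, j \in T & p = g j) in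
  same_set (gen [set: 'I_s]) I /\
  forall T : {set 'I_s}, T \proper [set: 'I_s] -> ~ same_set (gen T) I.

(** * Separability *)

(* Among the n+1 coordinates, [lift ord_max j] is the j-th one for j : 'I_n,
   and [ord_max] is the additional one. *)
Definition specialize (K : fieldType) n (i : 'I_n) (p : {mpoly K[n.+1]}) :
    {mpoly K[n]} :=
  comp_mpoly
    [tuple if unlift ord_max k is Some j then 'X_j else 'X_i | k < n.+1] p.

Definition separable_at (K : fieldType) n (L : 'rV[int]_n -> Prop) (i : 'I_n) :
    Prop :=
  exists L' : 'rV[int]_n.+1 -> Prop,
    [/\ is_lattice L' /\ saturated L',
        exists r, has_rank L' r /\ has_rank L r,
        same_set
          (fun p => exists2 q, lattice_ideal (K := K) L' q & p = specialize i q)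
          (lattice_ideal (K := K) L)
      & exists (s : nat) (w : 'I_s -> 'rV[int]_n.+1),
          minimal_generators (lattice_ideal (K := K) L')
            (fun j => lattice_binomial K (w j)) /\
          free [:: \row_(j < s) (w j 0 ord_max)%:~R;
                   \row_(j < s) (w j 0 (lift ord_max i))%:~R
                   : 'rV[rat]_s]].

(* Meant for saturated lattices [L]. *)
Definition inseparable (K : fieldType) n (L : 'rV[int]_n -> Prop) : Prop :=
  forall i : 'I_n, ~ separable_at K L i.

(** * The toric ring of a convex polyomino *)

Definition nvertices (P : {fset point}) : nat := size (vertices P).

Definition vertex (P : {fset point}) (k : 'I_(nvertices P)) : point :=
  tnth (in_tuple (vertices P)) k.

Definition relation_lattice (P : {fset point}) (u : 'rV[int]_(nvertices P)) :
    Prop :=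
  (forall i : nat, \sum_(k | (vertex k).1 == i) u 0 k = 0) /\
  (forall j : nat, \sum_(k | (vertex k).2 == j) u 0 k = 0).

Lemma relation_lattice_is_lattice P : is_lattice (@relation_lattice P).
Proof.
split; first by split=> i; rewrite big1 // => k _; rewrite mxE.
move=> u v [u1 u2] [v1 v2]; split=> i.
- under eq_bigr do rewrite !mxE.
  by rewrite big_split /= sumrN u1 v1 oppr0 addr0.
- under eq_bigr do rewrite !mxE.
  by rewrite big_split /= sumrN u2 v2 oppr0 addr0.
Qed.

Lemma relation_lattice_saturated P : saturated (@relation_lattice P).
Proof.
move=> m v m0 [v1 v2]; split=> i; apply: (mulfI m0); rewrite mulr0 mulr_sumr.
- by rewrite -[RHS](v1 i); apply: eq_bigr => k _; rewrite mxE.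
- by rewrite -[RHS](v2 i); apply: eq_bigr => k _; rewrite mxE.
Qed.

(* For a convex polyomino the ideal I_P of inner minors is the toric ideal
   of [relation_lattice P], and inseparability of the toric ring K[P] = S/I_P
   is by definition inseparability of this lattice. *)
Definition polyomino_ring_inseparable (K : fieldType) (P : {fset point}) :
    Prop :=
  inseparable K (@relation_lattice P).

(* Main.v *)
(* Let [phi : Z^(n+1) -> Z^n] add the additional coordinate to the coordinate
   of the vertex [i].  If [L'] separates [L] at [i], then [phi] maps [L'] onto
   [L], and equality of ranks makes it injective on [L'].  A rectangle whose
   corners are vertices gives a vector [u] of [L] such that the two terms of
   [f_u] form a whole fiber of [L]; hence [f_u], being in [pi_i(I_L')], comes
   from some [w] in [L'] with [phi w = u] and no cancellation, that is, with
   [w(n+1)] equal to [0] or [u(i)].  Comparing cells with dominoes, which do not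
   have [i] as a corner when [i] is on their middle edge, and using that the
   cells around [i] are connected through edges by convexity, one gets the same
   alternative for all cells.  The cell vectors span [L], so either [w(n+1) = 0]
   on [L'] or [w(i) = 0] on [L'].  Then [I_L'] is homogeneous for the degree in
   the corresponding variable, so the same coordinate vanishes on all the given
   generators, against linear independence. *)

From HB Require Import structures.
From Stdlib Require Import Reals Lra.
Require Import Defs.
From mathcomp Require Import all_boot all_order all_algebra.
From mathcomp Require Import finmap zify.
From mathcomp.multinomials Require Import mpoly.

Set Implicit Arguments.
Unset Strict Implicit.
Unset Printing Implicit Defensive.

Import Order.TTheory GRing.Theory Num.Theory.

(** * Convex polyominoes *)

Section CellCenters.
Local Open Scope R_scope.

(** A half-integer lies in only one unit interval with integer ends, so a cell center determines its
    cell. *)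
Lemma INR_eq_of_center (a x : nat) : INR a <= INR x + /2 <= INR a + 1 -> a = x.
Proof.
move=> [H1 H2].
have: (a < S x)%coq_nat by apply: INR_lt; rewrite S_INR; lra.
have: (x < S a)%coq_nat by apply: INR_lt; rewrite S_INR; lra.
by lia.
Qed.

Lemma region_center P x y :
  region P (INR x + /2, INR y + /2) <-> (x, y) \in P.
Proof.
split=> [[[a1 a2] aP [/= /INR_eq_of_center <- /INR_eq_of_center <-]]|xyP] //.
by exists (x, y) => //; split=> /=; lra.
Qed.

Lemma center_between (x1 x x2 : nat) : (x1 <= x <= x2)%N ->
  exists2 t, 0 <= t <= 1 &
    (1 - t) * (INR x1 + /2) + t * (INR x2 + /2) = INR x + /2.
Proof.
move=> /andP[/ssrnat.leP/le_INR l1 /ssrnat.leP/le_INR l2].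
have [e|ne] := Req_dec (INR x1) (INR x2); first by exists 0; lra.
exists ((INR x - INR x1) / (INR x2 - INR x1)); last by field; lra.
have d0 : 0 < INR x2 - INR x1 by lra.
split; first by apply: Rle_mult_inv_pos; lra.
by apply: (Rmult_le_reg_r _ _ _ d0); rewrite /Rdiv Rmult_assoc Rinv_l; lra.
Qed.

(** Convexity is applied on the line at height [y + 1/2], through the centers of the cells. *)
Lemma convex_row P x1 x x2 y : convex P ->
  (x1, y) \in P -> (x2, y) \in P -> (x1 <= x <= x2)%N -> (x, y) \in P.
Proof.
move=> [_ cH] /region_center h1 /region_center h2 /center_between[t t01 et].
have [] := cH _ _ _ t (conj h1 erefl) (conj h2 erefl) t01.
rewrite /= et => /[swap] _.
rewrite -Rmult_plus_distr_r (_ : 1 - t + t = 1); last by ring.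
by rewrite Rmult_1_l region_center.
Qed.

Lemma convex_col P x y1 y y2 : convex P ->
  (x, y1) \in P -> (x, y2) \in P -> (y1 <= y <= y2)%N -> (x, y) \in P.
Proof.
move=> [cV _] /region_center h1 /region_center h2 /center_between[t t01 et].
have [] := cV _ _ _ t (conj h1 erefl) (conj h2 erefl) t01.
rewrite /= et => /[swap] _.
rewrite -Rmult_plus_distr_r (_ : 1 - t + t = 1); last by ring.
by rewrite Rmult_1_l region_center.
Qed.

End CellCenters.

(** The common part is an edge of [a] whose two ends lie in [b]; this bounds the position of [b] for
    each of the four edges. *)
Lemma edge_adjacent_step a b : edge_adjacent a b ->
  (a.1 = b.1 /\ (a.2 <= b.2.+1 /\ b.2 <= a.2.+1))%N \/
  (a.2 = b.2 /\ (a.1 <= b.1.+1 /\ b.1 <= a.1.+1))%N.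
Proof.
move=> /andP[Ia _].
have inI c d : le_point c d -> (cell a `&` cell b)%fset = Defs.interval c d ->
    le_point b c /\ le_point d (shift b 1 1).
  move=> cd e.
  have : c \in Defs.interval c d by rewrite in_interval cd /le_point !leqnn.
  have : d \in Defs.interval c d by rewrite in_interval cd /le_point !leqnn.
  rewrite -e !in_fsetI !in_interval => /andP[_ /andP[_ ->]].
  by move=> /andP[_ /andP[-> _]].
move: Ia; rewrite /edges !inE.
by case/or4P=> /eqP/inI; rewrite /le_point /shift /=; lia.
Qed.

Lemma polyomino_connected P (Q : pred point) : polyomino P ->
  (forall c d, c \in P -> d \in P -> edge_adjacent c d -> Q c -> Q d) ->
  forall c d, c \in P -> d \in P -> Q c -> Q d.
Proof.
move=> [_ conn] step c d cP dP Qc; have [s [sP ps <-]] := conn c d cP dP.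
elim: s c cP Qc sP ps {conn dP} => //= e s IH c cP Qc /andP[eP sP] /andP[ce ps].
by apply: (IH e) => //; apply: (step c).
Qed.

(** If both cells were missing, no path could leave the quadrant [Q]: a step up would reach row
    [y.+1] at a column at most [x], and convexity with [(x.+1, y.+1)] would supply [(x, y.+1)];
    similarly for a step to the right. *)
Lemma diagonal_cells P x y : polyomino P -> convex P ->
  (x, y) \in P -> (x.+1, y.+1) \in P ->
  (x.+1, y) \in P \/ (x, y.+1) \in P.
Proof.
move=> pP cP p00 p11.
have [|n10] := boolP ((x.+1, y) \in P); first by left.
have [|n01] := boolP ((x, y.+1) \in P); first by right.
pose Q (c : point) := (c.1 <= x) && (c.2 <= y).
have step c d : c \in P -> d \in P -> edge_adjacent c d -> Q c -> Q d.
  rewrite /Q; case: c d => [c1 c2] [d1 d2] cin din /edge_adjacent_step /= cd Qc.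
  have [?|?] := leqP d1 x; have [?|?] := leqP d2 y => //=.
  - have e : d2 = y.+1 by lia.
    rewrite e in din; case/negP: n01.
    by apply: (convex_row cP din p11); lia.
  - have e : d1 = x.+1 by lia.
    rewrite e in din; case/negP: n10.
    by apply: (convex_col cP din p11); lia.
  - by lia.
have := polyomino_connected pP step p00 p11; rewrite /Q /= !leqnn ltnn.
by move=> /(_ isT).
Qed.

Lemma antidiagonal_cells P x y : polyomino P -> convex P ->
  (x.+1, y) \in P -> (x, y.+1) \in P ->
  (x, y) \in P \/ (x.+1, y.+1) \in P.
Proof.
move=> pP cP p10 p01.
have [|n00] := boolP ((x, y) \in P); first by left.
have [|n11] := boolP ((x.+1, y.+1) \in P); first by right.
pose Q (c : point) := (x < c.1) && (c.2 <= y).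
have step c d : c \in P -> d \in P -> edge_adjacent c d -> Q c -> Q d.
  rewrite /Q; case: c d => [c1 c2] [d1 d2] cin din /edge_adjacent_step /= cd Qc.
  have [?|?] := ltnP x d1; have [?|?] := leqP d2 y => //=.
  - have e : d2 = y.+1 by lia.
    rewrite e in din; case/negP: n11.
    by apply: (convex_row cP p01 din); lia.
  - have e : d1 = x by lia.
    rewrite e in din; case/negP: n00.
    by apply: (convex_col cP din p01); lia.
  - by lia.
have := polyomino_connected pP step p10 p01; rewrite /Q /= !leqnn ltnn.
by move=> /(_ isT).
Qed.

Lemma verticesP P v : reflect
  (exists2 c, c \in P & le_point c v && le_point v (shift c 1 1))
  (v \in vertices P).
Proof.
rewrite /vertices.
apply: (iffP (bigfcupP _ _ _ _)) => [[c /andP[cP _]]|[c cP h]].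
  by rewrite in_interval; exists c.
by exists c; rewrite ?cP ?in_interval.
Qed.

(* For a cell outside [P], its row lies on one side of it and its column on
   one side of it; the two remaining adjacent sides of the open quadrant
   opposite to both cannot be crossed by a path in [P]. *)
Lemma outside_cell_quadrant P a b : polyomino P -> convex P ->
  (a, b) \notin P ->
  exists sx sy : bool,
    let Q (v : point) := ((v.1 <= a) == sx) && ((v.2 <= b) == sy) in
    (forall v, v \in vertices P -> ~~ Q v) \/
    (forall v, v \in vertices P -> Q v).
Proof.
move=> pP cP nab.
(* [sx] is true when no cell of row [b] lies left of [a]; an empty row falls in this case. *)
have [sx hx] : exists sx : bool,
    forall x, (x, b) \in P -> (x < a) = ~~ sx /\ x != a.
  have [[x xP xa]|nx] : {x | (x, b) \in P & x < a} +
      (forall x, (x, b) \in P -> a <= x).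
    have [/hasP/sig2_eqW[c cin /andP[/eqP c2 c1]]|/hasPn h] :=
        boolP (has (fun c => (c.2 == b) && (c.1 < a)) P).
      by left; exists c.1; rewrite // -c2 -surjective_pairing.
    by right=> x /h /=; rewrite eqxx /= -leqNgt.
  - exists false => z zP; have za : z != a by apply: contraNneq nab => <-.
    split=> //; rewrite /= ltnNge; apply: contra nab => az.
    by apply: (convex_row cP xP zP); lia.
  - exists true => z zP; have za : z != a by apply: contraNneq nab => <-.
    by have := nx _ zP; lia.
have [sy hy] : exists sy : bool,
    forall y, (a, y) \in P -> (y < b) = ~~ sy /\ y != b.
  have [[y yP yb]|ny] : {y | (a, y) \in P & y < b} +
      (forall y, (a, y) \in P -> b <= y).
    have [/hasP/sig2_eqW[c cin /andP[/eqP c1 c2]]|/hasPn h] :=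
        boolP (has (fun c => (c.1 == a) && (c.2 < b)) P).
      by left; exists c.2; rewrite // -c1 -surjective_pairing.
    by right=> y /h /=; rewrite eqxx /= -leqNgt.
  - exists false => z zP; have zb : z != b by apply: contraNneq nab => <-.
    split=> //; rewrite /= ltnNge; apply: contra nab => bz.
    by apply: (convex_col cP yP zP); lia.
  - exists true => z zP; have zb : z != b by apply: contraNneq nab => <-.
    by have := ny _ zP; lia.
exists sx, sy.
(* Cells off row [b] and column [a], on the chosen sides; all their vertices satisfy the quadrant
   condition of the statement. *)
pose Q (c : point) :=
  [&& c.1 != a, c.2 != b, (c.1 < a) == sx & (c.2 < b) == sy].
have step c d : c \in P -> d \in P -> edge_adjacent c d -> Q c -> Q d.
  rewrite /Q; case: c d => [c1 c2] [d1 d2] cin din /edge_adjacent_step /= cd.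
  have [e1|n1] := eqVneq d1 a.
    by rewrite e1 in din cd; have := hy _ din; case: (sx) (sy) => -[]; lia.
  have [e2|n2] := eqVneq d2 b.
    by rewrite e2 in din cd; have := hx _ din; case: (sx) (sy) => -[]; lia.
  by case: (sx) (sy) => -[]; lia.
have [/hasP[c cin Qc]|/hasPn nQ] := boolP (has Q P); [right|left].
  move=> v /verticesP[d dP]; have := polyomino_connected pP step cin dP Qc.
  rewrite /Q /le_point /=.
  by case: (sx) (sy) => -[]; lia.
move=> v /verticesP[d dP]; have := nQ d dP; rewrite /Q /le_point /=.
case: d dP => d1 d2 dP /=.
have [e1|n1] := eqVneq d1 a.
  by rewrite e1 in dP *; have := hy _ dP; case: (sx) (sy) => -[]; lia.
have [e2|n2] := eqVneq d2 b.
  by rewrite e2 in dP *; have := hx _ dP; case: (sx) (sy) => -[]; lia.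
by case: (sx) (sy) => -[]; lia.
Qed.

Local Open Scope ring_scope.

(** * Binomials and gradings *)

Definition pos_part n (v : 'rV[int]_n) : 'X_{1..n} :=
  [multinom (if 0 <= v 0 k then absz (v 0 k) else 0%N)%R | k < n].

Lemma pos_partE n (v : 'rV[int]_n) k :
  pos_part v k = (if 0 <= v 0 k then absz (v 0 k) else 0%N)%R.
Proof. exact: mnmE. Qed.

Lemma pos_partB n (v : 'rV[int]_n) k :
  (pos_part v k)%:Z - (pos_part (- v) k)%:Z = v 0 k.
Proof.
by rewrite !pos_partE mxE oppr_ge0; move: (v 0 k) => z; do 2!case: ifP; lia.
Qed.

Lemma lattice_binomialE (K : fieldType) n (v : 'rV[int]_n) :
  lattice_binomial K v = 'X_[pos_part v] - 'X_[pos_part (- v)].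
Proof.
rewrite /lattice_binomial !mpolyXE_id big_mkcond [in X in _ - X]big_mkcond /=.
congr (_ - _); apply: eq_bigr => k _; rewrite pos_partE ?mxE.
  by case: ifP.
by rewrite oppr_ge0 abszN; case: ifP.
Qed.

Lemma rmorph_ideal_gen0 (A B : comNzRingType) (f : {rmorphism A -> B}) G p :
  (forall q, G q -> f q = 0) -> ideal_gen G p -> f p = 0.
Proof.
move=> fG [s [sG ->]]; rewrite rmorph_sum big_seq big1 // => q /sG/fG fq.
by rewrite rmorphM fq mulr0.
Qed.

(** Degree in the variables of [D] as a ring morphism: two monomials have the same image exactly
    when these degrees agree. *)
Definition grading (K : fieldType) n (D : pred 'I_n) :
    {mpoly K[n]} -> {poly K} :=
  mmap polyC (fun k => if D k then 'X else 1).

HB.instance Definition _ (K : fieldType) n (D : pred 'I_n) :=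
  GRing.RMorphism.copy (@grading K n D)
    (mmap polyC (fun k => if D k then 'X else 1)).

Lemma gradingX (K : fieldType) n (D : pred 'I_n) m :
  grading D 'X_[m] = 'X^(\sum_(k | D k) m k)%N :> {poly K}.
Proof.
rewrite /grading mmapX /mmap1 -prodrXr big_mkcond [RHS]big_mkcond /=.
by apply: eq_bigr => k _; case: ifP; rewrite ?expr1n.
Qed.

Lemma Posz_sum (I : Type) (r : seq I) (P : pred I) (F : I -> nat) :
  (\sum_(i <- r | P i) F i)%N%:Z = \sum_(i <- r | P i) (F i)%:Z.
Proof. exact: (big_morph Posz PoszD). Qed.

Lemma sum_pos_partB n (D : pred 'I_n) (v : 'rV[int]_n) :
  (\sum_(k | D k) pos_part v k)%N%:Z - (\sum_(k | D k) pos_part (- v) k)%N%:Z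
  = \sum_(k | D k) v 0 k.
Proof.
by rewrite !Posz_sum -sumrB; apply: eq_bigr => k _; rewrite pos_partB.
Qed.

(** Since sums over [D] vanish on [L], the two terms of each [f_v] have equal degree, so [grading D]
    kills the ideal. *)
Lemma binomial_degree (K : fieldType) n (L : 'rV[int]_n -> Prop)
    (D : pred 'I_n) m1 m2 :
  (forall u, L u -> \sum_(k | D k) u 0 k = 0) ->
  lattice_ideal (K := K) L ('X_[m1] - 'X_[m2]) ->
  (\sum_(k | D k) m1 k = \sum_(k | D k) m2 k)%N.
Proof.
move=> LD /(rmorph_ideal_gen0 (f := grading D)) H.
suff: grading D ('X_[m1] - 'X_[m2] : {mpoly K[n]}) = 0.
  rewrite rmorphB /= !gradingX => /eqP; rewrite subr_eq0 => /eqP.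
  by move=> /(congr1 (size \o polyseq)) /=; rewrite !size_polyXn => -[].
apply: H => _ [v /LD Lv ->]; rewrite lattice_binomialE rmorphB /= !gradingX.
suff -> : (\sum_(k | D k) pos_part v k = \sum_(k | D k) pos_part (- v) k)%N.
  by rewrite subrr.
by have := sum_pos_partB D v; rewrite Lv; lia.
Qed.

Lemma lattice_binomial_degree (K : fieldType) n (L : 'rV[int]_n -> Prop)
    (D : pred 'I_n) v :
  (forall u, L u -> \sum_(k | D k) u 0 k = 0) ->
  lattice_ideal (K := K) L (lattice_binomial K v) -> \sum_(k | D k) v 0 k = 0.
Proof.
move=> LD; rewrite lattice_binomialE => /(binomial_degree LD) e.
by rewrite -sum_pos_partB e subrr.
Qed.

Lemma mcoeff_MX_eq0 (R : nzRingType) n (a : {mpoly R[n]}) m k :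
  ~~ (m <= k)%MM -> (a * 'X_[m])@_k = 0.
Proof.
move=> nmk; apply: memN_msupp_eq0; apply: contra nmk.
rewrite (perm_mem (msuppMX _ _)) => /mapP[m' _ ->]; exact: lem_addr.
Qed.

Lemma mcoeff_mul_binomial (R : nzRingType) n (a : {mpoly R[n]}) m1 m2 k :
  (a * ('X_[m1] - 'X_[m2]))@_k != 0 -> m1 != m2 /\ ((m1 <= k) || (m2 <= k))%MM.
Proof.
move=> nz; split.
  by apply: contraNneq nz => ->; rewrite subrr mulr0 mcoeff0.
apply: contraNT nz; rewrite negb_or => /andP[n1 n2].
by rewrite mulrBr mcoeffB !mcoeff_MX_eq0 ?subrr.
Qed.

Lemma ideal_gen_mcoeff (R : comNzRingType) n G (p : {mpoly R[n]}) k :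
  ideal_gen G p -> p@_k != 0 -> exists a g, G g /\ (a * g)@_k != 0.
Proof.
move=> [s [sG ->]] nz.
have /hasP[q qs qk] : has (fun q => (q.1 * q.2)@_k != 0) s.
  apply: contraNT nz => /hasPn h.
  by rewrite raddf_sum big_seq big1 //= => q /h /negbNE/eqP.
by exists q.1, q.2; split; first exact: sG.
Qed.

(** * Merging the additional variable with the variable [i] *)

Definition merge_ix n (i : 'I_n) (k : 'I_n.+1) : 'I_n :=
  if unlift ord_max k is Some j then j else i.

Definition merge_mnm n (i : 'I_n) (m : 'X_{1..n.+1}) : 'X_{1..n} :=
  [multinom (\sum_(k | merge_ix i k == j) m k)%N | j < n].

(** The map [phi]; as a matrix product it is linear by construction and fits rank computations. *)
Definition merge_row n (i : 'I_n) (w : 'rV[int]_n.+1) : 'rV[int]_n :=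
  w *m \matrix_(k, j) (merge_ix i k == j)%:R.

Lemma merge_rowE n (i : 'I_n) w j :
  merge_row i w 0 j = \sum_(k | merge_ix i k == j) w 0 k.
Proof.
rewrite mxE [RHS]big_mkcond; apply: eq_bigr => k _; rewrite mxE.
by case: ifP; rewrite ?mulr1 ?mulr0.
Qed.

Lemma big_merge_ix (R : Type) (idx : R) (op : Monoid.com_law idx) n (i : 'I_n)
    (F : 'I_n.+1 -> R) :
  \big[op/idx]_(k | merge_ix i k == i) F k =
  op (F ord_max) (F (lift ord_max i)).
Proof.
have mx : merge_ix i ord_max = i by rewrite /merge_ix unlift_none.
have ml j : merge_ix i (lift ord_max j) = j by rewrite /merge_ix liftK.
rewrite (bigD1 ord_max) ?mx //=.
rewrite (bigD1 (lift ord_max i)) ?ml ?eqxx 1?eq_sym ?neq_lift //=.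
rewrite big1 ?Monoid.mulm1 // => k; case: (unliftP ord_max k) => [j|] ->.
  by rewrite ml; case: eqP => [->|]; rewrite ?eqxx ?andbF.
by rewrite eqxx andbF.
Qed.

Lemma merge_row_at n (i : 'I_n) w :
  merge_row i w 0 i = w 0 ord_max + w 0 (lift ord_max i).
Proof. by rewrite merge_rowE big_merge_ix. Qed.

Lemma merge_mnm_at n (i : 'I_n) m :
  merge_mnm i m i = (m ord_max + m (lift ord_max i))%N.
Proof. by rewrite mnmE big_merge_ix. Qed.

Lemma specializeX (K : fieldType) n (i : 'I_n) m :
  specialize i 'X_[m] = 'X_[merge_mnm i m] :> {mpoly K[n]}.
Proof.
rewrite /specialize comp_mpolyX.
transitivity (\prod_k 'X_(merge_ix i k) ^+ m k : {mpoly K[n]}).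
  by apply: eq_bigr => k _; rewrite tnth_mktuple /merge_ix; case: unlift.
rewrite mprodXnE; congr 'X_[_]; apply/mnmP => j.
rewrite mnm_sumE mnmE [RHS]big_mkcond; apply: eq_bigr => k _.
by rewrite mulmnE mnm1E; case: eqP; rewrite ?mul1n ?mul0n.
Qed.

(** This is [f] of [merge_row i w] only up to a common factor: a power of [x_i] appears when [w] has
    opposite signs at the two merged coordinates. *)
Lemma specialize_binomial (K : fieldType) n (i : 'I_n) w :
  specialize i (lattice_binomial K w) =
  'X_[merge_mnm i (pos_part w)] - 'X_[merge_mnm i (pos_part (- w))].
Proof.
by rewrite lattice_binomialE /specialize comp_mpolyB -!specializeX.
Qed.

Lemma merge_pos_partB n (i : 'I_n) w j :
  (merge_mnm i (pos_part w) j)%:Z - (merge_mnm i (pos_part (- w)) j)%:Z =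
  merge_row i w 0 j.
Proof. by rewrite !mnmE sum_pos_partB merge_rowE. Qed.

(* If the coefficient of a monomial in the combination of the specialized
   binomials expressing [f_u] is nonzero, one of these binomials has a term
   dividing the monomial; the other terms of the fiber leave no room for the
   merged binomial to be anything but [f_u] without common factor. *)
Lemma lift_binomial (K : fieldType) n (i : 'I_n) (L : 'rV[int]_n -> Prop)
    (L' : 'rV[int]_n.+1 -> Prop) u q :
  is_lattice L' ->
  (forall w, L' w -> L (merge_row i w)) ->
  (forall (t : 'X_{1..n}) v, L v ->
     (forall k, (t k)%:Z = (pos_part u k)%:Z + v 0 k) ->
     t = pos_part u \/ t = pos_part (- u)) ->
  u != 0 -> `|u 0 i| <= 1 ->
  lattice_ideal (K := K) L' q -> lattice_binomial K u = specialize i q ->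
  exists2 w, L' w &
    merge_row i w = u /\ (w 0 ord_max = 0 \/ w 0 ord_max = u 0 i).
Proof.
move=> [L'0 L'B] LL fib u0 ui [s [sL ->]] eu.
pose k := pos_part u.
have uk : (lattice_binomial K u)@_k != 0.
  rewrite lattice_binomialE mcoeffB !mcoeffX eqxx.
  suff /negPf -> : pos_part (- u) != k by rewrite subr0 oner_neq0.
  apply: contraNneq u0 => e; apply/eqP/rowP => j.
  by rewrite -pos_partB e subrr mxE.
have [a [_ [[w Lw ->]]]] : exists a g,
    (exists2 w, L' w & g = specialize i (lattice_binomial K w)) /\
    (a * g : {mpoly K[n]})@_k != 0.
  apply: ideal_gen_mcoeff uk; rewrite eu.
  exists [seq (specialize i q.1, specialize i q.2) | q <- s]; split.
    by move=> _ /mapP[q' /sL [w Lw e] ->]; exists w; rewrite //= e.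
  rewrite /specialize raddf_sum /= big_map.
  by apply: eq_bigr => q' _; rewrite rmorphM.
rewrite specialize_binomial => /mcoeff_mul_binomial[nm].
(* Passing to [- w] exchanges the two terms, so the dividing term may be taken to be the first. *)
wlog mk : w Lw nm / (merge_mnm i (pos_part w) <= k)%MM => [IH /orP[h|h]|_].
- by apply: (IH w) => //; rewrite h.
- apply: (IH (- w)); rewrite ?opprK // 1?eq_sym ?h //.
  by rewrite -sub0r; apply: L'B.
have mkj j := mnm_lepP mk j.
have := merge_pos_partB i w; set m1 := merge_mnm i _; set m2 := merge_mnm i _.
(* Exchanging the factor [m1] of [k] for [m2] stays in the fiber of [k], since the exponents change
   by [- merge_row i w]. *)
move=> m12; have := fib (k - m1 + m2)%MM (- merge_row i w).
case=> [|j|e|e].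
- by rewrite -mulNmx; apply: LL; rewrite -sub0r; apply: L'B.
- rewrite mnmDE mnmBE mxE -m12; have := mkj j; rewrite -/m1 /k.
  by move: (m1 j) (m2 j) (pos_part u j) => x y z; lia.
- case/eqP: nm; apply/mnmP => j.
  have := congr1 (fun m : 'X_{1..n} => m j) e; have := mkj j.
  rewrite mnmDE mnmBE -/m1 -/m2 /k.
  by move: (m1 j) (m2 j) (pos_part u j) => x y z; lia.
have mwu : merge_row i w = u.
  apply/rowP => j; rewrite -m12 -pos_partB -e; have := mkj j.
  rewrite mnmDE mnmBE -/m1 -/m2 /k.
  by move: (m1 j) (m2 j) (pos_part u j) => x y z; lia.
(* At [i], [m1] and [m2] are now the positive and negative parts of [u 0 i], of total at most 1; so
   one of the two merged coordinates of [w] is 0. *)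
exists w => //; split=> //; clear -mkj e mwu ui.
have := merge_row_at i w; rewrite mwu.
have := mkj i; have := congr1 (fun m : 'X_{1..n} => m i) e.
rewrite mnmDE mnmBE !merge_mnm_at /k !pos_partE !mxE.
move: ui; rewrite ler_norml.
move: (w 0 ord_max) (w 0 (lift ord_max i)) (u 0 i) => x y z.
have [?|?] := leP 0 x; have [?|?] := leP 0 y; have [?|?] := leP 0 z;
  rewrite ?oppr_ge0; do ?case: ifP; lia.
Qed.

(** * Cell vectors span the relation lattice *)

Lemma vertex_in P (k : 'I_(nvertices P)) : vertex k \in vertices P.
Proof. exact: mem_tnth. Qed.

Lemma vertex_inj P : injective (@vertex P).
Proof. by apply/tuple_uniqP; exact: fset_uniq. Qed.

Lemma vertex_surj P p : p \in vertices P ->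
  exists k : 'I_(nvertices P), vertex k = p.
Proof. by move=> /(tnthP (in_tuple (vertices P)))[k ->]; exists k. Qed.

Lemma sum_vertex P (Q : pred point) p : p \in vertices P ->
  \sum_(k | Q (@vertex P k)) (vertex k == p)%:Z = (Q p)%:Z.
Proof.
move=> /vertex_surj[k0 <-]; rewrite big_mkcond (bigD1 k0) //= eqxx.
rewrite big1 ?addr0 => [|k /negPf kn]; first by case: (Q _).
by rewrite (inj_eq (@vertex_inj P)) kn; case: ifP.
Qed.

(** * Rectangle vectors and their fibers *)

Definition rect_vec P (p q : point) : 'rV[int]_(nvertices P) :=
  \row_k ((vertex k == p)%:Z + (vertex k == q)%:Z
          - (vertex k == (p.1, q.2))%:Z - (vertex k == (q.1, p.2))%:Z).

Definition corners_in P (p q : point) : Prop :=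
  [/\ p \in vertices P, q \in vertices P, (p.1, q.2) \in vertices P
    & (q.1, p.2) \in vertices P].

Lemma rect_vec_relation P p q :
  corners_in P p q -> relation_lattice (rect_vec P p q).
Proof.
move=> [pV qV pqV qpV]; split=> r; under eq_bigr do rewrite mxE.
  rewrite !(sumrB, big_split) /= !(sum_vertex (fun v => v.1 == r)) //=.
  by case: (p.1 == r); case: (q.1 == r).
rewrite !(sumrB, big_split) /= !(sum_vertex (fun v => v.2 == r)) //=.
by case: (p.2 == r); case: (q.2 == r).
Qed.

Lemma pos_part_rect P p q k : (p.1 < q.1)%N -> (p.2 < q.2)%N ->
  pos_part (rect_vec P p q) k = ((vertex k == p) + (vertex k == q))%N.
Proof.
case: p q => [p1 p2] [q1 q2] /= l1 l2; rewrite pos_partE mxE /=.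
by case: (vertex k) => v1 v2; rewrite !xpair_eqE;
  (do ?case: eqP => /= ?); lia.
Qed.

Lemma pos_part_rectN P p q k : (p.1 < q.1)%N -> (p.2 < q.2)%N ->
  pos_part (- rect_vec P p q) k =
  ((vertex k == (p.1, q.2)) + (vertex k == (q.1, p.2)))%N.
Proof.
case: p q => [p1 p2] [q1 q2] /= l1 l2; rewrite pos_partE !mxE /=.
by case: (vertex k) => v1 v2; rewrite !xpair_eqE;
  (do ?case: eqP => /= ?); lia.
Qed.

Lemma rect_vec_norm P p q k : (p.1 < q.1)%N -> (p.2 < q.2)%N ->
  `|rect_vec P p q 0 k| <= 1.
Proof.
case: p q => [p1 p2] [q1 q2] /= l1 l2; rewrite mxE /=.
by case: (vertex k) => v1 v2; rewrite !xpair_eqE ler_norml;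
  (do ?case: eqP => /= ?); lia.
Qed.

Lemma rect_vec_neq0 P p q : (p.1 < q.1)%N -> (p.2 < q.2)%N ->
  p \in vertices P -> rect_vec P p q != 0.
Proof.
case: p q => [p1 p2] [q1 q2] /= l1 l2 /vertex_surj[k ek].
apply/eqP => /rowP/(_ k); rewrite !mxE ek !xpair_eqE /=.
by (do ?case: eqP => /= ?); lia.
Qed.

Lemma sum_pair (I : finType) (D : pred I) (t : I -> nat) a b :
  a != b -> D a -> D b -> (forall k, D k -> k != a -> k != b -> t k = 0%N) ->
  (\sum_(k | D k) t k = t a + t b)%N.
Proof.
move=> ab Da Db t0; rewrite (bigD1 a) //= (bigD1 b) /= ?Db 1?eq_sym //.
by rewrite big1 ?addn0 // => k /andP[/andP[Dk ka] kb]; apply: t0.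
Qed.

(** [t] is a nonnegative table with the row and column sums of [x_p x_q]. These confine it to the
    four corners with all margins 1, and such a 2 by 2 table is a permutation matrix. *)
Lemma rect_fiber P p q (t : 'X_{1..nvertices P}) v :
  (p.1 < q.1)%N -> (p.2 < q.2)%N -> corners_in P p q ->
  relation_lattice v ->
  (forall k, (t k)%:Z = (pos_part (rect_vec P p q) k)%:Z + v 0 k) ->
  t = pos_part (rect_vec P p q) \/ t = pos_part (- rect_vec P p q).
Proof.
move=> l1 l2 [pV qV pqV qpV] [v1 v2] te.
have tk k : (t k)%:Z = (vertex k == p)%:Z + (vertex k == q)%:Z + v 0 k.
  by rewrite te pos_part_rect // PoszD.
have row r : (\sum_(k | (vertex k).1 == r) t k = (p.1 == r) + (q.1 == r))%N.
  apply/eqP; rewrite -eqz_nat Posz_sum; under eq_bigr do rewrite tk.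
  by rewrite !big_split /= v1 addr0 !(sum_vertex (fun v => v.1 == r)).
have col r : (\sum_(k | (vertex k).2 == r) t k = (p.2 == r) + (q.2 == r))%N.
  apply/eqP; rewrite -eqz_nat Posz_sum; under eq_bigr do rewrite tk.
  by rewrite !big_split /= v2 addr0 !(sum_vertex (fun v => v.2 == r)).
have supp k : t k != 0%N ->
    ((vertex k).1 == p.1) || ((vertex k).1 == q.1) /\
    ((vertex k).2 == p.2) || ((vertex k).2 == q.2).
  move=> tk0; split.
    have := row (vertex k).1; rewrite (bigD1 k) //= ![(vertex k).1 == _]eq_sym.
    by case: (p.1 == _) (q.1 == _) => -[] //; lia.
  have := col (vertex k).2; rewrite (bigD1 k) //= ![(vertex k).2 == _]eq_sym.
  by case: (p.2 == _) (q.2 == _) => -[] //; lia.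
have [k1 e1] := vertex_surj pV; have [k2 e2] := vertex_surj qV.
have [k3 e3] := vertex_surj pqV; have [k4 e4] := vertex_surj qpV.
have vE (k k' : 'I_(nvertices P)) : (k == k') = (vertex k == vertex k').
  by symmetry; apply: (inj_eq (@vertex_inj P)).
have out k : k != k1 -> k != k2 -> k != k3 -> k != k4 -> t k = 0%N.
  rewrite !vE e1 e2 e3 e4; have [//|/supp] := eqVneq (t k) 0%N.
  case: (vertex k) p q {l1 l2 pV qV pqV qpV te tk row col supp e1 e2 e3 e4}
    => [a b] [p1 p2] [q1 q2]; rewrite !xpair_eqE /=.
  by lia.
have on_line (D : pred 'I_(nvertices P)) a b a' b' :
    [/\ D a, D b, ~~ D a' & ~~ D b'] -> a != b ->
    (forall k, k != a -> k != b -> k != a' -> k != b' -> t k = 0%N) ->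
    (\sum_(k | D k) t k = t a + t b)%N.
  move=> [Da Db Da' Db'] ab z; apply: sum_pair => // k Dk ka kb; apply: z => //.
    by apply: contraNneq Da' => <-.
  by apply: contraNneq Db' => <-.
have n12 : (p.1 == q.1) = false by lia.
have n21 : (q.1 == p.1) = false by lia.
have m12 : (p.2 == q.2) = false by lia.
have m21 : (q.2 == p.2) = false by lia.
have r1 : (t k1 + t k3 = 1)%N.
  rewrite -(on_line (fun k => (vertex k).1 == p.1) k1 k3 k2 k4).
  - by rewrite row eqxx n21.
  - by rewrite e1 e2 e3 e4 /= eqxx n21.
  - rewrite vE e1 e3; case: (p) (q) m12 => [? ?] [? ?] /=.
    by rewrite xpair_eqE => ->; rewrite andbF.
  - by move=> k *; apply: out.
have r2 : (t k2 + t k4 = 1)%N.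
  rewrite -(on_line (fun k => (vertex k).1 == q.1) k2 k4 k1 k3).
  - by rewrite row eqxx n12.
  - by rewrite e1 e2 e3 e4 /= eqxx n12.
  - rewrite vE e2 e4; case: (p) (q) m21 => [? ?] [? ?] /=.
    by rewrite xpair_eqE => ->; rewrite andbF.
  - by move=> k *; apply: out.
have c1 : (t k1 + t k4 = 1)%N.
  rewrite -(on_line (fun k => (vertex k).2 == p.2) k1 k4 k2 k3).
  - by rewrite col eqxx m21.
  - by rewrite e1 e2 e3 e4 /= eqxx m21.
  - rewrite vE e1 e4; case: (p) (q) n12 => [? ?] [? ?] /=.
    by rewrite xpair_eqE => ->.
  - by move=> k *; apply: out.
(* By the margins, diagonally opposite corners carry equal entries. *)
have tE k : t k =
   (t k1 * ((vertex k == p) + (vertex k == q)) +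
    t k3 * ((vertex k == (p.1, q.2)) + (vertex k == (q.1, p.2))))%N.
  rewrite -e3 -e4 -e1 -e2 -!vE.
  have d (a b : 'I_(nvertices P)) : vertex a != vertex b -> (a == b) = false.
    by rewrite vE => /negPf.
  have d12 : (k1 == k2) = false.
    by apply: d; rewrite e1 e2; apply: contraFneq n12 => ->.
  have d34 : (k3 == k4) = false.
    by apply: d; rewrite e3 e4 xpair_eqE n12.
  have d13 : (k1 == k3) = false.
    by apply: d; rewrite e1 e3; apply: contraFneq m12 => {1}->.
  have d14 : (k1 == k4) = false.
    by apply: d; rewrite e1 e4; apply: contraFneq n12 => {1}->.
  have d23 : (k2 == k3) = false.
    by apply: d; rewrite e2 e3; apply: contraFneq n21 => {1}->.
  have d24 : (k2 == k4) = false.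
    by apply: d; rewrite e2 e4; apply: contraFneq m21 => {1}->.
  have [->|/out h1] := eqVneq k k1.
    by rewrite /= d12 d13 d14 !addn0 muln1 muln0 addn0.
  have [->|/h1 h2] := eqVneq k k2.
    rewrite /= d23 d24 add0n muln1 muln0 addn0.
    by apply: (@addIn (t k4)); rewrite r2 c1.
  have [->|/h2 h3] := eqVneq k k3.
    by rewrite /= d34 !addn0 muln1 muln0.
  have [->|/h3 ->] := eqVneq k k4; last by rewrite !muln0.
  by rewrite /= muln0 muln1; apply: (@addnI (t k1)); rewrite r1 c1.
have [[z1 z3]|[z1 z3]] : (t k1 = 1 /\ t k3 = 0 \/ t k1 = 0 /\ t k3 = 1)%N.
- by move: r1; move: (t k1) (t k3) => x y; clear; lia.
- by left; apply/mnmP => k; rewrite pos_part_rect // tE z1 z3 mul1n addn0.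
- by right; apply/mnmP => k; rewrite pos_part_rectN // tE z1 z3 mul1n.
Qed.

(** * Expansion of a relation in cell vectors *)

Definition cell_vec P (c : point) : 'rV[int]_(nvertices P) :=
  rect_vec P c (shift c 1 1).

(** Two-dimensional partial sums of [u]. The value at [c.1.+1], [c.2.+1], which includes the vertex
    [c] itself, will be the coefficient of the cell [c]. *)
Definition quadrant_sum P (u : 'rV[int]_(nvertices P)) (a b : nat) : int :=
  \sum_(k | ((vertex k).1 < a)%N && ((vertex k).2 < b)%N) u 0 k.

Lemma sum_fibers_eq0 (I : finType) (f : I -> nat) (F : I -> int)
    (Q : pred nat) :
  (forall r, \sum_(k | f k == r) F k = 0) -> \sum_(k | Q (f k)) F k = 0.
Proof.
move=> F0; pose N := (\max_k f k)%N.
have hN k : (f k < N.+1)%N by exact: (leq_bigmax (F := f)).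
rewrite (partition_big (fun k => inord (f k) : 'I_N.+1)
           (fun r : 'I_N.+1 => Q r)) /=; last by move=> k; rewrite inordK.
apply: big1 => r Qr; rewrite -[RHS](F0 r); apply: eq_bigl => k.
rewrite -val_eqE /= inordK //.
by case: eqP => [->|_]; rewrite ?Qr ?andbF.
Qed.

Lemma sum_rows P (u : 'rV[int]_(nvertices P)) (Q : pred nat) :
  relation_lattice u -> \sum_(k | Q (vertex k).1) u 0 k = 0.
Proof. by move=> [/(sum_fibers_eq0 Q)]. Qed.

Lemma sum_cols P (u : 'rV[int]_(nvertices P)) (Q : pred nat) :
  relation_lattice u -> \sum_(k | Q (vertex k).2) u 0 k = 0.
Proof. by move=> [_ /(sum_fibers_eq0 Q)]. Qed.

(** The lines through the center of the missing cell cut the vertices into four quadrants. The row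
    and column conditions give adjacent quadrants opposite sums, and one sum is 0 because that
    quadrant holds no vertex or all of them. *)
Lemma quadrant_sum_outside P u a b : polyomino P -> convex P ->
  relation_lattice u -> (a, b) \notin P ->
  quadrant_sum (P := P) u a.+1 b.+1 = 0.
Proof.
move=> pP cP Lu /(outside_cell_quadrant pP cP)[sx [sy h]].
pose S (s t : bool) := \sum_(k : 'I_(nvertices P)
  | (((vertex k).1 <= a)%N == s) && (((vertex k).2 <= b)%N == t)) u 0 k.
have S0 : S sx sy = 0.
  case: h => h; first by rewrite /S big_pred0 // => k; exact/negbTE/h/vertex_in.
  rewrite -[RHS](sum_rows xpredT Lu); apply: eq_bigl => k.
  by rewrite h ?vertex_in.
have rowS s : S s true + S s false = 0.
  rewrite -[RHS](sum_rows (fun r => (r <= a)%N == s) Lu).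
  rewrite [RHS](bigID (fun k => (vertex k).2 <= b)%N) /=.
  by congr (_ + _); apply: eq_bigl => k; case: (_ <= b)%N;
    rewrite ?andbT ?andbF.
have colS t : S true t + S false t = 0.
  rewrite -[RHS](sum_cols (fun r => (r <= b)%N == t) Lu).
  rewrite [RHS](bigID (fun k => (vertex k).1 <= a)%N) /=.
  by congr (_ + _); apply: eq_bigl => k; case: (_ <= a)%N;
    rewrite ?andbT ?andbF //= andbC.
transitivity (S true true).
  by apply: eq_bigl => k; rewrite !ltnS !eqb_id.
case: sx sy S0 {h} => -[] S0 //.
- by have := rowS true; rewrite S0 addr0.
- by have := colS true; rewrite S0 addr0.
have := colS true; have := rowS false; rewrite S0 addr0 => ->.
by rewrite addr0.
Qed.

(** Only the cell at [v - (i, j)] can contribute; if it is outside [P], its quadrant sum vanishes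
    anyway. *)
Lemma sum_quadrant_shift P u v i j : polyomino P -> convex P ->
  relation_lattice u ->
  \sum_(c <- P) quadrant_sum (P := P) u c.1.+1 c.2.+1 * (v == shift c i j)%:Z =
  quadrant_sum u (v.1.+1 - i) (v.2.+1 - j).
Proof.
move=> pP cP Lu; have [/andP[h1 h2]|hn] := boolP ((i <= v.1) && (j <= v.2))%N.
  pose c0 : point := (v.1 - i, v.2 - j)%N.
  have vE c : (v == shift c i j) = (c == c0).
    rewrite /shift /c0; case: c v h1 h2 {c0} => [? ?] [? ?] /= h1 h2.
    by rewrite !xpair_eqE; lia.
  have -> : (v.1.+1 - i = c0.1.+1)%N by rewrite subSn.
  have -> : (v.2.+1 - j = c0.2.+1)%N by rewrite subSn.
  under eq_bigr do rewrite vE.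
  have [c0P|/(quadrant_sum_outside pP cP Lu) z] := boolP (c0 \in P).
    rewrite (bigD1_seq c0) ?fset_uniq //= eqxx mulr1 big1 ?addr0 // => c.
    by move=> /negPf ->; rewrite mulr0.
  rewrite [RHS]z big1 // => c _; case: eqP => [->|_]; last by rewrite mulr0.
  by rewrite [quadrant_sum _ _ _]z mul0r.
(* No cell corner fits here; truncated subtraction turns one bound on the right into 0, so that sum
   is empty. *)
rewrite big1 => [|c _].
  rewrite /quadrant_sum big_pred0 // => k; apply/negbTE; move: hn.
  by rewrite negb_and -!ltnNge => /orP[] h; lia.
rewrite (_ : _ == _ = false) ?mulr0 //; apply: contraNF hn => /eqP ->.
by rewrite /shift /= !leq_addl.
Qed.

(** At each vertex the right side is a mixed second difference of quadrant sums, which returns the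
    entry of [u] there. *)
Lemma cell_vec_expansion P u : polyomino P -> convex P -> relation_lattice u ->
  u = \sum_(c <- P) quadrant_sum (P := P) u c.1.+1 c.2.+1 *: cell_vec P c.
Proof.
move=> pP cP Lu; apply/rowP => k; rewrite summxE.
have cE c : cell_vec P c 0 k =
    (vertex k == shift c 0 0)%:Z + (vertex k == shift c 1 1)%:Z
    - (vertex k == shift c 0 1)%:Z - (vertex k == shift c 1 0)%:Z.
  by rewrite mxE /shift /= !addn0; case: c.
under eq_bigr do rewrite mxE cE !mulrBr mulrDr.

rewrite !sumrB big_split /= !sum_quadrant_shift // !subSS !subn0.
pose x := (vertex k).1; pose y := (vertex k).2.
pose g a b k' := if ((vertex (P := P) k').1 < a)%N && ((vertex k').2 < b)%N
  then u 0 k' else 0.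
have gE a b : quadrant_sum u a b = \sum_k' g a b k' by exact: big_mkcond.
transitivity
  (\sum_k' (g x.+1 y.+1 k' + g x y k' - g x.+1 y k' - g x y.+1 k')).
  rewrite (bigD1 k) //= /g !ltnn !ltnSn /= !subr0.
  rewrite big1 ?addr0 // => k'.
  rewrite -(inj_eq (@vertex_inj P)) /x /y.
  case: (vertex k) (vertex k') => [x0 y0] [x1 y1] /=.
  by rewrite xpair_eqE !ltnS; (do ?case: ifP); lia.
by rewrite !sumrB big_split /= !gE.
Qed.

Lemma lattice_sum n (M : 'rV[int]_n -> Prop) (I : eqType) (s : seq I) F :
  is_lattice M -> (forall i, i \in s -> M (F i)) -> M (\sum_(i <- s) F i).
Proof.
move=> [M0 MB] MF; rewrite big_seq; apply: big_ind => // u v Mu Mv.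
by rewrite -[v]opprK; apply: (MB) => //; rewrite -sub0r; apply: MB.
Qed.

Lemma lattice_scale n (M : 'rV[int]_n -> Prop) (z : int) u :
  is_lattice M -> M u -> M (z *: u).
Proof.
move=> LM Mu; have MN v : M v -> M (- v).
  by rewrite -sub0r; apply: LM.2; apply: LM.1.
have MX k : M (u *+ k).
  elim: k => [|k IH]; first exact: LM.1.
  by rewrite mulrS -[_ *+ k]opprK; apply: LM.2 => //; apply: MN.
case: z => k; first by rewrite -natz scaler_nat.
by rewrite NegzE scaleNr -natz scaler_nat; apply: MN.
Qed.
Lemma relation_lattice_cells_ind P (M : 'rV[int]_(nvertices P) -> Prop) u :
  polyomino P -> convex P -> is_lattice M ->
  (forall c, c \in P -> M (cell_vec P c)) -> relation_lattice u -> M u.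
Proof.
move=> pP cP LM Mc Lu; rewrite (cell_vec_expansion pP cP Lu).
by apply: lattice_sum => // c cin; apply: lattice_scale => //; apply: Mc.
Qed.

(** * Corners of cells and dominoes *)

Lemma cell_corner P c i j : c \in P -> (i <= 1)%N -> (j <= 1)%N ->
  shift c i j \in vertices P.
Proof.
move=> cin i1 j1; apply/verticesP; exists c => //.
by rewrite /le_point /shift /= !leq_addr !leq_add2l i1 j1.
Qed.

Lemma cell_corners P c : c \in P -> corners_in P c (shift c 1 1).
Proof.
case: c => x y cin; split=> /=.
- by have := cell_corner (i := 0) (j := 0) cin; rewrite /shift /= !addn0; apply.
- exact: cell_corner.
- by have := cell_corner (i := 0) (j := 1) cin; rewrite /shift /= addn0; apply.
- by have := cell_corner (i := 1) (j := 0) cin; rewrite /shift /= addn0; apply.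
Qed.

(** The two cell vectors cancel on the common edge, leaving the outer corners. *)
Lemma row_domino P x y : (x, y) \in P -> (x.+1, y) \in P ->
  corners_in P (x, y) (x.+2, y.+1) /\
  rect_vec P (x, y) (x.+2, y.+1) = cell_vec P (x, y) + cell_vec P (x.+1, y).
Proof.
move=> c1 c2; have [v1 _ v2 _] := cell_corners c1.
have [_ v3 _ v4] := cell_corners c2; split.
  by split=> //=; move: v2 v3 v4; rewrite /shift /= !addn1.
apply/rowP => k; rewrite !mxE /shift /= !addn1.
by (do !move: (Posz _) => ?); lia.
Qed.

Lemma col_domino P x y : (x, y) \in P -> (x, y.+1) \in P ->
  corners_in P (x, y) (x.+1, y.+2) /\
  rect_vec P (x, y) (x.+1, y.+2) = cell_vec P (x, y) + cell_vec P (x, y.+1).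
Proof.
move=> c1 c2; have [v1 _ _ v2] := cell_corners c1.
have [_ v3 v4 _] := cell_corners c2; split.
  by split=> //=; move: v2 v3 v4; rewrite /shift /= !addn1.
apply/rowP => k; rewrite !mxE /shift /= !addn1.
by (do !move: (Posz _) => ?); lia.
Qed.

(** [B] factors through [B' *m G], so the latter has rank [r] over the rationals; hence no nonzero
    combination of the rows of [B'] merges to 0. *)
Lemma merge_inj_on n (i : 'I_n) r (L : 'rV[int]_n -> Prop) L' :
  has_rank L' r -> has_rank L r ->
  (forall u, L u -> exists2 w, L' w & merge_row i w = u) ->
  forall w, L' w -> merge_row i w = 0 -> w = 0.
Proof.
move=> [B' [_ LB']] [B [freeB LB]] LL' w /LB'[c ->] c0.
pose G := \matrix_(k, j) (merge_ix i k == j)%:R : 'M[int]_(n.+1, n).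
have /fin_all_exists[C CE] j : exists d : 'rV[int]_r, row j B = d *m B' *m G.
  have [|w' /LB'[d ->] <-] := LL' (row j B); last by exists d.
  by apply/LB; exists (delta_mx 0 j); rewrite rowE.
pose toQ m1 m2 (A : 'M[int]_(m1, m2)) := map_mx (intr : int -> rat) A.
have toQM m1 m2 m3 (A1 : 'M_(m1, m2)) (A2 : 'M_(m2, m3)) :
  toQ _ _ (A1 *m A2) = toQ _ _ A1 *m toQ _ _ A2 by exact: map_mxM.
have freeB' : row_free (toQ _ _ (B' *m G)).
  rewrite /row_free eqn_leq rank_leq_row /= -{1}(eqP freeB).
  have -> : B = (\matrix_j C j) *m (B' *m G).
    by apply/row_matrixP => j; rewrite row_mul rowK CE mulmxA.
  by rewrite -/(toQ _ _ _) toQM mxrankM_maxr.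
have : toQ _ _ c *m toQ _ _ (B' *m G) == 0.
  by rewrite -toQM mulmxA (c0 : _ *m G = 0) /toQ map_mx0.
rewrite mulmx_free_eq0 // => /eqP cQ.
suff -> : c = 0 by rewrite mul0mx.
apply/rowP => j; have /rowP/(_ j) := cQ; rewrite !mxE => /eqP.
by rewrite intr_eq0 => /eqP.
Qed.

(** * Separations of the relation lattice *)

Section Separation.
Variables (K : fieldType) (P : {fset point}) (i : 'I_(nvertices P)).
Variables (L' : 'rV[int]_(nvertices P).+1 -> Prop) (r : nat).
Hypotheses (pP : polyomino P) (cP : convex P) (LL' : is_lattice L').
Hypotheses (rankL' : has_rank L' r) (rankL : has_rank (@relation_lattice P) r).
Hypothesis LI : same_set
  (fun p => exists2 q, lattice_ideal (K := K) L' q & p = specialize i q)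
  (lattice_ideal (K := K) (@relation_lattice P)).

(** The specialized binomial of [w] lies in the ideal of the relation lattice, so its monomials have
    equal degree along every line of vertices; the difference of these degrees is the sum of
    [merge_row i w] on that line. *)
Lemma merge_row_relation w : L' w -> relation_lattice (merge_row i w).
Proof.
move=> Lw.
have : lattice_ideal (K := K) (@relation_lattice P)
    (specialize i (lattice_binomial K w)).
  apply/LI; exists (lattice_binomial K w) => //.
  exists [:: (1, lattice_binomial K w)]; rewrite big_seq1 mul1r; split=> // q.
  by rewrite inE => /eqP ->; exists w.
rewrite specialize_binomial => Iw.
have sum0 (D : pred 'I_(nvertices P)) :
    (forall u, relation_lattice u -> \sum_(k | D k) u 0 k = 0) ->
    \sum_(k | D k) merge_row i w 0 k = 0.
  move=> /binomial_degree/(_ Iw) e.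
  under eq_bigr do rewrite -merge_pos_partB.
  by rewrite sumrB -!Posz_sum e subrr.
by split=> a; apply: sum0 => u [].
Qed.

Lemma rect_lift p q : (p.1 < q.1)%N -> (p.2 < q.2)%N -> corners_in P p q ->
  exists2 w, L' w & merge_row i w = rect_vec P p q /\
    (w 0 ord_max = 0 \/ w 0 ord_max = rect_vec P p q 0 i).
Proof.
move=> l1 l2 pq; have [pV _ _ _] := pq.
have [|f If ef] := (LI (lattice_binomial K (rect_vec P p q))).2.
  exists [:: (1, lattice_binomial K (rect_vec P p q))].
  rewrite big_seq1 mul1r; split=> // g.
  rewrite inE => /eqP ->; exists (rect_vec P p q) => //.
  exact: rect_vec_relation.
apply: (lift_binomial LL' merge_row_relation _ _ _ If ef).
- by move=> t v; exact: rect_fiber.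
- exact: rect_vec_neq0.
- exact: rect_vec_norm.
Qed.

(** For [a = 0] the additional coordinate vanishes, for [a = 1] it takes all of [u 0 i]. The common
    form is linear in [u], so the condition can be checked on cells. *)
Definition extra_coord (a : int) (u : 'rV[int]_(nvertices P)) : Prop :=
  exists2 w, L' w & merge_row i w = u /\ w 0 ord_max = a * u 0 i.

Lemma cell_lift c : c \in P ->
  extra_coord 0 (cell_vec P c) \/ extra_coord 1 (cell_vec P c).
Proof.
move=> cin; have [||w Lw [ew [e|e]]] := rect_lift _ _ (cell_corners cin).
- by rewrite /= addn1.
- by rewrite /= addn1.
- by left; exists w; rewrite // mul0r.
- by right; exists w; rewrite // mul1r.
Qed.

Lemma merge_row_inj w w' :
  L' w -> L' w' -> merge_row i w = merge_row i w' -> w = w'.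
Proof.
move=> Lw Lw' e; apply/eqP; rewrite -subr_eq0; apply/eqP.
apply: (merge_inj_on (i := i) rankL' rankL) => [u||].
- apply: (relation_lattice_cells_ind
    (M := fun u => exists2 w, L' w & merge_row i w = u) pP cP).
    split; first by exists 0; [exact: LL'.1|rewrite /merge_row mul0mx].
    move=> _ _ [w1 L1 <-] [w2 L2 <-]; exists (w1 - w2); first exact: LL'.2.
    by rewrite /merge_row mulmxBl.
  by move=> c /cell_lift[] [w1 L1 [e1 _]]; exists w1.
- exact: LL'.2.
- by rewrite /merge_row mulmxBl -/(merge_row i w) e subrr.
Qed.

Lemma extra_coord_lattice a : is_lattice (extra_coord a).
Proof.
split; first by exists 0; [exact: LL'.1|rewrite /merge_row mul0mx !mxE mulr0].
move=> _ _ [w1 L1 [<- e1]] [w2 L2 [<- e2]].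
exists (w1 - w2); first exact: LL'.2.
have subE n (u v : 'rV[int]_n) k : (u - v) 0 k = u 0 k - v 0 k by rewrite 2!mxE.
by split; [rewrite /merge_row mulmxBl|rewrite !subE e1 e2 mulrBr].
Qed.

(* As the vertex [i] is not a corner of the domino [c1 + c2], the domino lifts
   with additional coordinate [0]. *)
Lemma extra_coord_domino a p q c1 c2 : c2 \in P ->
  (p.1 < q.1)%N -> (p.2 < q.2)%N -> corners_in P p q ->
  rect_vec P p q = cell_vec P c1 + cell_vec P c2 -> rect_vec P p q 0 i = 0 ->
  extra_coord a (cell_vec P c1) -> extra_coord a (cell_vec P c2).
Proof.
move=> c2P l1 l2 pq pqE pq0 [w1 Lw1 [ew1 w1m]].
have [w Lw [ew]] := rect_lift l1 l2 pq; rewrite pq0 => wm.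
exists (w - w1); first exact: LL'.2.
have E : merge_row i (w - w1) = cell_vec P c2.
  by rewrite /merge_row mulmxBl -!/(merge_row i _) ew ew1 pqE addrC addKr.
have w0 : w 0 ord_max = 0 by case: wm.
have := congr1 (fun v : 'rV_ _ => v 0 i) pqE.
rewrite /= pq0 mxE [_ + _]addrC => /esym/addr0_eq cE.
by split=> //; rewrite 2!mxE w0 w1m -cE mulrN opprK add0r.
Qed.

(** When the cells differ, [i] lies on the vertical line of their common edge, where the domino
    vector is 0. *)
Lemma extra_coord_row a x x' y : (x, y) \in P -> (x', y) \in P ->
  (x <= (vertex i).1 <= x.+1)%N -> (x' <= (vertex i).1 <= x'.+1)%N ->
  extra_coord a (cell_vec P (x, y)) -> extra_coord a (cell_vec P (x', y)).
Proof.
move=> c c' h h'; have [<- //|ne] := eqVneq x x'.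
have step z : (vertex i).1 = z.+1 -> rect_vec P (z, y) (z.+2, y.+1) 0 i = 0.
  move=> ei; rewrite mxE (surjective_pairing (vertex i)) ei !xpair_eqE /=.
  by rewrite eqSS [z == z.+1]ltn_eqF // [z.+1 == z]gtn_eqF.
have [e|e] : x' = x.+1 \/ x = x'.+1 by lia.
  rewrite e in c' h' *; have [pq pqE] := row_domino c c'.
  apply: (extra_coord_domino c' _ _ pq pqE) => //=; apply: step; lia.
rewrite e in c h *; have [pq pqE] := row_domino c' c; rewrite addrC in pqE.
apply: (extra_coord_domino c' _ _ pq pqE) => //=; apply: step; lia.
Qed.

Lemma extra_coord_col a x y y' : (x, y) \in P -> (x, y') \in P ->
  (y <= (vertex i).2 <= y.+1)%N -> (y' <= (vertex i).2 <= y'.+1)%N ->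
  extra_coord a (cell_vec P (x, y)) -> extra_coord a (cell_vec P (x, y')).
Proof.
move=> c c' h h'; have [<- //|ne] := eqVneq y y'.
have step z : (vertex i).2 = z.+1 -> rect_vec P (x, z) (x.+1, z.+2) 0 i = 0.
  move=> ei; rewrite mxE (surjective_pairing (vertex i)) ei !xpair_eqE /=.
  by rewrite eqSS [z == z.+1]ltn_eqF // [z.+1 == z]gtn_eqF ?andbF.
have [e|e] : y' = y.+1 \/ y = y'.+1 by lia.
  rewrite e in c' h' *; have [pq pqE] := col_domino c c'.
  apply: (extra_coord_domino c' _ _ pq pqE) => //=; apply: step; lia.
rewrite e in c h *; have [pq pqE] := col_domino c' c; rewrite addrC in pqE.
apply: (extra_coord_domino c' _ _ pq pqE) => //=; apply: step; lia.
Qed.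

(** For cells touching only at a corner, connectedness and convexity supply a cell sharing an edge
    with both; otherwise [(x, y)] itself serves. *)
Lemma corner_cells x x' y y' : (x, y) \in P -> (x', y') \in P ->
  (x <= x'.+1)%N -> (x' <= x.+1)%N -> (y <= y'.+1)%N -> (y' <= y.+1)%N ->
  (x', y) \in P \/ (x, y') \in P.
Proof.
move=> c c' h1 h2 h3 h4.
have [<-|nx] := eqVneq x x'; first by left.
have [<-|ny] := eqVneq y y'; first by right.
have [ex|ex] : x' = x.+1 \/ x = x'.+1 by lia.
  have [ey|ey] : y' = y.+1 \/ y = y'.+1 by lia.
    by rewrite ex ey in c' *; exact: diagonal_cells.
  by rewrite ex ey in c c' *; have [] := antidiagonal_cells pP cP c' c; auto.
have [ey|ey] : y' = y.+1 \/ y = y'.+1 by lia.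
  by rewrite ex ey in c c' *; exact: antidiagonal_cells.
by rewrite ex ey in c *; have [] := diagonal_cells pP cP c' c; auto.
Qed.

(** The [a] found at one cell around [i] is carried to all cells around [i]. The vectors of other
    cells are 0 at [i], so there both values of [a] impose the same condition. *)
Lemma extra_coord_cells : exists2 a : int, a = 0 \/ a = 1 &
  forall c, c \in P -> extra_coord a (cell_vec P c).
Proof.
have /verticesP[[x y] cin] := vertex_in i; rewrite /le_point /shift /= => hc.
have [a a01 ca] : exists2 a : int, a = 0 \/ a = 1
    & extra_coord a (cell_vec P (x, y)).
  by case: (cell_lift cin) => h; [exists 0|exists 1]; auto.
exists a => // -[x' y'] c'.
have [h|far] := boolP
  ((x' <= (vertex i).1 <= x'.+1) && (y' <= (vertex i).2 <= y'.+1))%N.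
  have [||||d|d] := corner_cells cin c'; try lia.
    apply: (extra_coord_col d c'); try lia.
    by apply: (extra_coord_row cin d) => //; lia.
  apply: (extra_coord_row d c'); try lia.
  by apply: (extra_coord_col cin d) => //; lia.
have c0 : cell_vec P (x', y') 0 i = 0.
  rewrite mxE /shift /= !addn1 (surjective_pairing (vertex i)) !xpair_eqE /=.
  move: far; move: (vertex i).1 (vertex i).2 => v1 v2.
  by (do ?case: eqP => /= ?); lia.
case: (cell_lift c') => -[w Lw [ew]]; rewrite c0 mulr0 => wm;
  by exists w; rewrite // c0 mulr0.
Qed.

Lemma extra_coord_cases :
  (forall w, L' w -> w 0 ord_max = 0) \/
  (forall w, L' w -> w 0 (lift ord_max i) = 0).
Proof.
have [a a01 ac] := extra_coord_cells.
have aw w : L' w -> w 0 ord_max = a * merge_row i w 0 i.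
  move=> Lw; have Ru := relation_lattice_cells_ind pP cP
    (extra_coord_lattice a) ac (merge_row_relation Lw).
  (* By injectivity, the lift assembled from the cells is [w] itself. *)
  by have [w' Lw' [e <-]] := Ru; rewrite (merge_row_inj Lw' Lw e).
case: a01 aw {ac} => -> aw; [left|right] => w /aw; first by rewrite mul0r.
rewrite mul1r merge_row_at => e.
by apply: (@addrI _ (w 0 ord_max)); rewrite addr0 -e.
Qed.

End Separation.

Theorem theorem5p7 (K : fieldType) (P : {fset point}) :
  [pchar K]%R =i pred0 -> polyomino P -> convex P ->
  polyomino_ring_inseparable K P.
Proof.
move=> _ pP cP i [L' [[LL' _] [r [rankL' rankL]] LI [s [w [[genL' _] fr]]]]].
have wI j : lattice_ideal (K := K) L' (lattice_binomial K (w j)).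
  apply/genL'; exists [:: (1, lattice_binomial K (w j))].
  rewrite big_seq1 mul1r; split=> // q; rewrite inE => /eqP ->.
  by exists j; rewrite ?inE.
(* The generators are only known to have their binomials in the ideal; homogeneity in the single
   variable [k] carries the vanishing over from [L']. *)
have w0 k : (forall v, L' v -> v 0 k = 0) -> forall j, w j 0 k = 0.
  move=> L0 j; have := lattice_binomial_degree (D := pred1 k) _ (wI j).
  by rewrite big_pred1_eq; apply=> u /L0; rewrite big_pred1_eq.
have := free_not0 fr.
case: (extra_coord_cases pP cP LL' rankL' rankL LI) => /w0 z nz.
  have /negP[] := nz _ (mem_head _ _).
  by apply/eqP/rowP => j; rewrite !mxE z.
have /negP[] := nz _ (mem_last _ _).
by apply/eqP/rowP => j; rewrite !mxE z.
Qed.
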